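(* Let $M$ be a closed oriented $3$-manifold, $L\subset M$ a framed link with $n$ components, and let $f:\mathrm I_r^n\to\mathbb C$ be the function $f(\mathbf m)=\mathrm{RT}_r(M,L,\mathbf m)$ given by the relative Reshetikhin-Turaev invariants, either in the $SU(2)$ theory (any integer $r\geqslant3$, $q=e^{\pi\sqrt{-1}/r}$) or in the $SO(3)$ theory ($r\geqslant3$ odd, $q=e^{2\pi\sqrt{-1}/r}$). Let $\widehat f:\mathrm I_r^n\to\mathbb C$ be its (full) discrete Fourier transform $$\widehat f(\mathbf n)=\mu_r^{n}\sum_{\mathbf m\in\mathrm I_r^n}\ \prod_{i=1}^n\mathrm H(m_i,n_i)\,f(\mathbf m),\qquad \mathrm H(m,k)=(-1)^{m+k}\frac{q^{(m+1)(k+1)}-q^{-(m+1)(k+1)}}{q-q^{-1}}.$$ Then $$\sum_{\mathbf m\in \mathrm I_r^n}|f(\mathbf m)|^2=\sum_{\mathbf n\in \mathrm I_r^n}|\widehat f(\mathbf n)|^2.$$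
   Context: $SU(2)$ theory: $q=e^{\pi\sqrt{-1}/r}$, $A=e^{\pi\sqrt{-1}/(2r)}$, $\mathrm I_r=\{0,1,\dots,r-2\}$, $\mu_r=\frac{\sqrt2\sin(\pi/r)}{\sqrt r}$. $SO(3)$ theory: $r$ odd, $q=e^{2\pi\sqrt{-1}/r}$, $A=e^{\pi\sqrt{-1}/r}$, $\mathrm I_r=\{0,2,\dots,r-3\}$, $\mu_r=\frac{2\sin(2\pi/r)}{\sqrt r}$. In both cases $q=A^2$, and $\langle\ \rangle$ is the Kauffman bracket of framed links in $S^3$ (crossing $=A\cdot$ one smoothing $+A^{-1}\cdot$ the other, loop value $-A^2-A^{-2}$, empty link $\mapsto1$). In the skein algebra $\mathbb C[z]$ of the thickened annulus ($z$ the core), $e_0=1$, $e_1=z$, $e_k=ze_{k-1}-e_{k-2}$; $[k]=\frac{q^k-q^{-k}}{q-q^{-1}}$; and $\Omega_r=\mu_r\sum_{k\in \mathrm I_r}(-1)^k[k+1]e_k$. If $M$ is obtained from $S^3$ by surgery along a framed link $L'$ and $L\subset M$ is a framed link with $n$ components colored by $\mathbf m\in\mathrm I_r^n$, $$\mathrm{RT}_r(M,L,\mathbf m)=\mu_r\langle e_{m_1},\dots,e_{m_n},\Omega_r,\dots,\Omega_r\rangle_{D(L\cup L')}\,\langle\Omega_r\rangle_{U_+}^{-\sigma(L')},$$ where $D(L\cup L')$ is a diagram whose blackboard framing is the given framing, $e_{m_k}$ is cabled along the $k$-th component of $L$ and $\Omega_r$ along each component of $L'$, $U_+$ is the unknot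 with framing $1$, and $\sigma(L')$ is the signature of the linking matrix of $L'$. *)

(* Defs.v *)
From HB Require Import structures.
From mathcomp Require Import all_boot all_order all_algebra.
From mathcomp Require Import all_classical all_reals all_analysis.
From mathcomp Require Import complex polyrcf.

Set Implicit Arguments.
Unset Strict Implicit.
Unset Printing Implicit Defensive.

Import Order.TTheory GRing.Theory Num.Theory.
Import numFieldNormedType.Exports.

Local Open Scope classical_set_scope.
Local Open Scope ring_scope.
Local Open Scope complex_scope.

(* Space is (R * R) * R: p.1 is the projection of p to the plane of link
   diagrams, and p.2 is its height above that plane. *)
Definition plane2 (R : realType) : Type := (R * R)%type.
Definition space3 (R : realType) : Type := (R * R * R)%type.
HB.instance Definition _ (R : realType) := NormedModule.on (plane2 R).
HB.instance Definition _ (R : realType) := NormedModule.on (space3 R).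

Definition sphere3 (R : realType) := one_point_compactification (space3 R).

Section Manifolds.
Variable R : realType.
Local Notation V := (space3 R).

(* Local degree +1 at x: the map y |-> g y - g x, from a punctured ball around x
   to the punctured space, is homotopic to the translation y |-> y - x. *)
Definition preserves_orientation_at (g : V -> V) (x : V) : Prop :=
  exists (e : R) (H : R -> V -> V),
    let A := [set p : R * V |
               [/\ 0 <= p.1 <= 1, ball x e p.2 & p.2 <> x]] in
    [/\ 0 < e,
        {within A, continuous (fun p : R * V => H p.1 p.2)},
        forall p, A p -> H p.1 p.2 <> 0,
        forall y, H 0 y = g y - g x
      & forall y, H 1 y = y - x].

(* c is an open embedding; a is a map defined near x with a x in the range of c.
   The local transition c^-1 o a preserves the orientation at x. *)
Definition cooriented_at (X : topologicalType) (c a : V -> X) (x : V) : Prop :=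
  exists g : V -> V,
    (\forall y \near x, c (g y) = a y) /\ preserves_orientation_at g x.

Record closed_oriented_3manifold := ClosedOriented3Manifold {
  carrier :> topologicalType;
  charts : set (V -> carrier); (* positively oriented local parametrizations *)
  manifold_hausdorff : hausdorff_space carrier;
  manifold_compact : compact [set: carrier];
  chart_open_embedding : forall c, charts c ->
    [/\ continuous c, injective c & forall U, open U -> open (c @` U)];
  charts_cover : forall m : carrier, exists2 c, charts c & range c m;
  charts_oriented : forall c c' x, charts c -> charts c' ->
    range c' (c x) -> cooriented_at c' c x }.

Definition circle : set (plane2 R) := [set x | x.1 ^+ 2 + x.2 ^+ 2 = 1].
Definition disk : set (plane2 R) := [set x | x.1 ^+ 2 + x.2 ^+ 2 <= 1].
Definition open_disk : set (plane2 R) := [set x | x.1 ^+ 2 + x.2 ^+ 2 < 1].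

Definition solid_torus : set (plane2 R * plane2 R) := circle `*` disk.
Definition open_solid_torus : set (plane2 R * plane2 R) := circle `*` open_disk.
(* circle x [0, 1], where [0, 1] is a radius of the disk *)
Definition band : set (plane2 R * plane2 R) :=
  [set p | [/\ circle p.1, 0 <= p.2.1 <= 1 & p.2.2 = 0]].

(* A (tame) framed link with components indexed by I: disjoint embedded solid
   tori. The i-th component is the image of circle x {0}, and its framing is
   given by the annulus, image of the band. *)
Record framed_link (X : topologicalType) (I : Type) := FramedLink {
  tube :> I -> plane2 R * plane2 R -> X;
  tube_continuous : forall i, {within solid_torus, continuous (tube i)};
  tube_injective : forall i j p q, solid_torus p -> solid_torus q ->
    tube i p = tube j q -> i = j /\ p = q }.

Definition exterior (X : topologicalType) (I : Type)
    (t : I -> plane2 R * plane2 R -> X) : set X :=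
  [set x | forall i, ~ (t i @` open_solid_torus) x].

End Manifolds.

(* Oriented link diagrams, described by arcs and crossings. At each crossing an
   overstrand passes from the arc over_in to the arc over_out, and an
   understrand from under_in to under_out; positive tells the sign of the
   crossing. The relation joined tells which arcs are glued end to end away
   from the crossings. *)
Record arc_diagram := ArcDiagram {
  arc : finType;
  joined : rel arc;
  xing : finType;
  over_in : xing -> arc;
  over_out : xing -> arc;
  under_in : xing -> arc;
  under_out : xing -> arc;
  positive : pred xing }.

Section KauffmanBracket.
Variables (F : fieldType) (A : F) (D : arc_diagram).

(* s c = true stands for the smoothing with coefficient A, which respects the
   orientations exactly when the crossing is positive. *)
Definition smoothed (s : {ffun xing D -> bool}) : rel (arc D) :=
  [rel x y | joined x y ||
    [exists c, if s c == positive c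
      then (x == over_in c) && (y == under_out c)
           || (x == under_in c) && (y == over_out c)
      else (x == over_in c) && (y == under_in c)
           || (x == over_out c) && (y == under_out c)]].

Definition loops (s : {ffun xing D -> bool}) : nat :=
  n_comp [rel x y | smoothed s x y || smoothed s y x] predT.

Definition kauffman_bracket : F :=
  \sum_(s : {ffun xing D -> bool})
    (\prod_c (if s c then A else A^-1)) * (- A ^+ 2 - A ^- 2) ^+ loops s.

End KauffmanBracket.

(* A link made of closed polygons in space; the vertices of a component are in
   cyclic order, so that the component is oriented. *)
Record polygonal_link (R : realType) (I : finType) := PolygonalLink {
  len : I -> nat;
  vertex : forall i, 'I_(len i) -> space3 R }.

Section PolygonalLink.
Variables (R : realType) (I : finType) (K : polygonal_link R I).

Definition edge : finType := {i : I & 'I_(len K i)}.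
Definition component (e : edge) : I := tag e.
Definition next_edge (e : edge) : edge :=
  Tagged (fun i => 'I_(len K i)) (ordS (tagged e)).
Definition edge_source (e : edge) : space3 R := vertex (tagged e).
Definition edge_target (e : edge) : space3 R := edge_source (next_edge e).
Definition edge_point (e : edge) (t : R) : space3 R :=
  (1 - t) *: edge_source e + t *: edge_target e.

Definition edges_det (e e' : edge) : R :=
  let u := (edge_target e - edge_source e).1 in
  let v := (edge_target e' - edge_source e').1 in
  u.1 * v.2 - u.2 * v.1.

Definition crosses_over (o u : edge) : bool :=
  `[< exists s t : R, [/\ 0 < s < 1, 0 < t < 1,
        (edge_point o s).1 = (edge_point u t).1
      & (edge_point u t).2 < (edge_point o s).2] >].

Definition crosses (e e' : edge) : bool :=
  crosses_over e e' || crosses_over e' e.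

Definition crossing_sign (o u : edge) : int := sgz (edges_det o u).

(* The projection to the plane is a link diagram. Edges are moreover subdivided
   so that each one is involved in at most one crossing. *)
Definition regular_projection : Prop :=
  [/\ forall i, (2 < len K i)%N,
      forall e, (edge_source e).1 <> (edge_target e).1,
      forall (e e' : edge) (s t : R), e <> e' -> 0 <= s <= 1 -> 0 <= t <= 1 ->
        (edge_point e s).1 = (edge_point e' t).1 ->
        [\/ [/\ e' = next_edge e, s = 1 & t = 0],
            [/\ e = next_edge e', s = 0 & t = 1]
          | [/\ 0 < s < 1, 0 < t < 1, edges_det e e' <> 0
              & (edge_point e s).2 <> (edge_point e' t).2]]
    & forall e e1 e2, crosses e e1 -> crosses e e2 -> e1 = e2].

(* For i != j this is the linking number, half of the sum of the signs of the
   crossings between the two components; for i = j this is the writhe of the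
   component, which is its blackboard framing. *)
Definition linking (i j : I) : R :=
  (\sum_(o | component o == i)
      \sum_(u | (component u == j) && crosses_over o u) crossing_sign o u
   + \sum_(o | component o == j)
      \sum_(u | (component u == i) && crosses_over o u) crossing_sign o u)%:~R
  / 2.

(* Cables: the i-th component is replaced by k i parallel copies, numbered from
    left to right with respect to its orientation. *)
Section Cable.
Variable k : I -> nat.

Definition strands (e : edge) : nat := k (component e).
(* number of strands of the cable crossed by each copy of e *)
Definition cuts (e : edge) : nat := (\sum_(e' | crosses e e') strands e')%N.

(* (e, (i, s)) is the s-th piece of the i-th copy of the edge e *)
Definition cable_arc : finType :=
  {e : edge & ('I_(strands e) * 'I_(cuts e).+1)%type}.
Definition piece (e : edge) (i : 'I_(strands e)) (s : nat) : cable_arc :=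
  Tagged (fun e => ('I_(strands e) * 'I_(cuts e).+1)%type) (i, inord s).

Definition cable_joined : rel cable_arc := fun x y =>
  let: (i, s) := tagged x in
  let: (j, t) := tagged y in
  [&& tag y == next_edge (tag x), val i == val j,
      val s == cuts (tag x) & val t == 0%N].

Definition base_xing : finType := {p : edge * edge | crosses_over p.1 p.2}.
Definition over (c : base_xing) : edge := (val c).1.
Definition under (c : base_xing) : edge := (val c).2.

(* (c, (i, j)) is the crossing of the i-th copy of over c and the j-th copy of
   under c *)
Definition cable_xing : finType :=
  {c : base_xing & ('I_(strands (over c)) * 'I_(strands (under c)))%type}.

Definition cable_positive : pred cable_xing :=
  fun x => 0 < edges_det (over (tag x)) (under (tag x)).

(* At a positive crossing, the understrands pass from the right to the left of
   the overstrands, and at a negative one from the left to the right. *)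
Definition over_rank (x : cable_xing) : nat :=
  let: (_, j) := tagged x in
  if cable_positive x then j else rev_ord j.
Definition under_rank (x : cable_xing) : nat :=
  let: (i, _) := tagged x in
  if cable_positive x then rev_ord i else i.

Definition cable : arc_diagram := @ArcDiagram cable_arc cable_joined cable_xing
  (fun x => piece (tagged x).1 (over_rank x))
  (fun x => piece (tagged x).1 (over_rank x).+1)
  (fun x => piece (tagged x).2 (under_rank x))
  (fun x => piece (tagged x).2 (under_rank x).+1)
  cable_positive.

End Cable.

(* < P i, i in I >: the i-th component is cabled by P i in the skein algebra
   C[z] of the annulus, where z^k stands for k parallel copies of the core. *)
Definition skein_bracket (F : fieldType) (A : F) (P : I -> {poly F}) : F :=
  \sum_(k : {ffun I -> 'I_(\max_i size (P i))})
    (\prod_i (P i)`_(k i)) * kauffman_bracket A (cable (fun i => k i)).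

End PolygonalLink.

(* A closed curve with a single crossing, which is positive. *)
Definition unknot_plus (R : realType) : polygonal_link R unit :=
  @PolygonalLink R unit (fun=> 4%N)
    (fun _ a => nth (0, 0, 0)
      [:: (-1, -1, 1); (1, 1, 1); (1, -1, 0); (-1, 1, 0)] a).

(* number of positive minus number of negative eigenvalues, with multiplicity *)
Definition signature (R : realType) (n : nat) (S : 'M[R]_n) : int :=
  \sum_(a <- rootsR (char_poly S)) sgz a * (\rank (eigenspace S a))%:Z.

Section Surgery.
Variable R : realType.

(* The link diagram of K represents the framed link t: the components of t are
   the polygons of K, and the framing of t is the blackboard framing, i.e., the
   projection to the plane immerses the framing annuli near the components. *)
Definition is_diagram_of (I : finType) (K : polygonal_link R I)
    (t : I -> plane2 R * plane2 R -> space3 R) : Prop :=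
  [/\ regular_projection K,
      forall i, [set t i (x, 0) | x in @circle R] =
        [set y | exists (e : edge K) (s : R),
                   [/\ component e = i, 0 <= s <= 1 & y = edge_point e s]]
    & forall i x, @circle R x -> exists2 U, nbhs (x, 0 : plane2 R) U &
        forall q q', U q -> U q' -> @band R q -> @band R q' ->
          (t i q).1 = (t i q').1 -> q = q'].

(* A presentation of (M, L) as the result of surgery along a framed link L' in
   the 3-sphere, together with a diagram of the union of L and L' (both isotoped
   away from the point at infinity). Components indexed by inl are those of L,
   and components indexed by inr are those of L'.
   - surgery_map is a homeomorphism from the exterior of L' to the exterior of
     the glued solid tori;
   - it maps the curve x |-> (x, 1) on the boundary of a tube of L', which
     represents the framing, to the meridian x |-> (1, x) of the solid torus
     glued there;
   - the orientation of M extends that of the exterior of L' in the sphere,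
     oriented by the identity of space. *)
Record surgery_presentation (M : closed_oriented_3manifold R) (n : nat)
    (L : framed_link R M 'I_n) := SurgeryPresentation {
  surgery_size : nat;
  presented_link : framed_link R (space3 R) ('I_n + 'I_surgery_size)%type;
  diagram : polygonal_link R ('I_n + 'I_surgery_size)%type;
  diagramP : is_diagram_of diagram presented_link;
  glued_tori : framed_link R M 'I_surgery_size;
  surgery_map : sphere3 R -> M;
  surgery_exterior :
    let X := exterior (fun i p => Some (presented_link (inr i) p) : sphere3 R) in
    [/\ {within X, continuous surgery_map},
        {in X &, injective surgery_map}
      & surgery_map @` X = exterior glued_tori];
  surgery_gluing : forall i x y, @circle R x -> @circle R y ->
    surgery_map (Some (presented_link (inr i) (x, y))) = glued_tori i (y, x);
  surgery_orientation : forall (x : space3 R) (c : space3 R -> M), charts c ->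
    (forall i, ~ (presented_link (inr i) @` @solid_torus R) x) ->
    range c (surgery_map (Some x)) ->
    cooriented_at c (fun y => surgery_map (Some y)) x;
  surgery_link : forall j p, @solid_torus R p ->
    L j p = surgery_map (Some (presented_link (inl j) p)) }.

Definition surgery_linking_matrix (M : closed_oriented_3manifold R) (n : nat)
    (L : framed_link R M 'I_n) (P : surgery_presentation L) :
    'M[R]_(surgery_size P) :=
  \matrix_(i, j) linking (diagram P) (inr i) (inr j).

End Surgery.

Inductive theory := SU2 | SO3.

Definition admissible (T : theory) (r : nat) : bool :=
  match T with SU2 => 3 <= r | SO3 => (3 <= r) && odd r end%N.

Definition in_colors (T : theory) (r k : nat) : bool :=
  match T with SU2 => k <= r - 2 | SO3 => (k <= r - 3) && ~~ odd k end%N.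

Definition color (T : theory) (r : nat) : finType :=
  {k : 'I_r | in_colors T r k}.

Definition color_val (T : theory) (r : nat) (k : color T r) : nat := val (val k).

Section RT.
Variables (R : realType) (T : theory) (r : nat).
Local Notation C := R[i].

Definition expi (t : R) : C := cos t +i* sin t.

Definition rt_q : C :=
  match T with SU2 => expi (pi / r%:R) | SO3 => expi (2 * pi / r%:R) end.

Definition rt_A : C :=
  match T with SU2 => expi (pi / (2 * r%:R)) | SO3 => expi (pi / r%:R) end.

Definition rt_mu : C :=
  (match T with
   | SU2 => Num.sqrt 2 * sin (pi / r%:R) / Num.sqrt r%:R
   | SO3 => 2 * sin (2 * pi / r%:R) / Num.sqrt r%:R
   end)%:C.

Definition qint (k : nat) : C :=
  (rt_q ^+ k - rt_q ^- k) / (rt_q - rt_q^-1).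

Fixpoint skein_e (k : nat) : {poly C} :=
  match k with
  | 0 => 1
  | k'.+1 => if k' is k''.+1 then 'X * skein_e k' - skein_e k'' else 'X
  end.

Definition Omega : {poly C} :=
  rt_mu *: \sum_(k : color T r)
    ((-1) ^+ color_val k * qint (color_val k).+1) *: skein_e (color_val k).

Definition RT (M : closed_oriented_3manifold R) (n : nat)
    (L : framed_link R M 'I_n) (P : surgery_presentation L)
    (m : {ffun 'I_n -> color T r}) : C :=
  rt_mu
  * skein_bracket (diagram P) rt_A
      (fun i => match i with
                | inl j => skein_e (color_val (m j))
                | inr _ => Omega
                end)
  * skein_bracket (unknot_plus R) rt_A (fun=> Omega)
      ^ (- signature (surgery_linking_matrix P)).

Definition fourier_kernel (m k : nat) : C :=
  (-1) ^+ (m + k)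
  * ((rt_q ^+ (m.+1 * k.+1) - rt_q ^- (m.+1 * k.+1)) / (rt_q - rt_q^-1)).

Definition fourier (n : nat) (f : {ffun 'I_n -> color T r} -> C)
    (k : {ffun 'I_n -> color T r}) : C :=
  rt_mu ^+ n *
  \sum_(m : {ffun 'I_n -> color T r})
    (\prod_i fourier_kernel (color_val (m i)) (color_val (k i))) * f m.

End RT.

(* Main.v *)
(* The Parseval identity holds for any function on the colorings, because the
   transform is a tensor power of the matrix mu_r H on I_r, which is real and
   orthogonal. Orthogonality reduces to that of the characters of Z/N, where N
   is the order of q (2r for SU(2), r for SO(3)): the summand is even in the
   summation index and vanishes at 0 and r, so the sum over I_r is half of a
   sum over Z/N. *)
Require Import Defs.
From mathcomp Require Import all_boot all_order all_algebra.
From mathcomp Require Import all_classical all_reals all_analysis.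
From mathcomp Require Import complex ring lra zify.
Import Order.TTheory GRing.Theory Num.Theory.

Local Open Scope ring_scope.

(** * Parseval's identity for tensor powers of a unitary kernel *)

Lemma parseval_ffun (F : numClosedFieldType) (I C : finType) (K : C -> C -> F)
    (f : {ffun I -> C} -> F) :
  (forall m m', \sum_k K m k * (K m' k)^* = (m == m')%:R) ->
  \sum_(k : {ffun I -> C})
    `|\sum_(m : {ffun I -> C}) (\prod_i K (m i) (k i)) * f m| ^+ 2 =
  \sum_m `|f m| ^+ 2.
Proof.
move=> unitaryK.
transitivity
  (\sum_(k : {ffun I -> C}) \sum_(m : {ffun I -> C}) \sum_(m' : {ffun I -> C})
    (\prod_i K (m i) (k i)) * f m * ((\prod_i K (m' i) (k i)) * f m')^*).
  apply: eq_bigr => k _; rewrite normCK rmorph_sum mulr_suml.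
  by apply: eq_bigr => m _; rewrite mulr_sumr.
(* With the sum over [k] innermost, distributivity turns it into a product over coordinates of the
   sums given by [unitaryK]; for [m' != m] one factor vanishes. *)
rewrite exchange_big; apply: eq_bigr => m _.
rewrite exchange_big (bigD1 m) //= [X in _ + X]big1 ?addr0 => [|m' m'_neq].
- under eq_bigr do rewrite rmorphM rmorph_prod /= mulrACA -big_split /=.
  rewrite -mulr_suml -(bigA_distr_bigA (fun i k => K (m i) k * (K (m i) k)^*)).
  by rewrite big1 ?mul1r ?normCK // => i _; rewrite unitaryK eqxx.
under eq_bigr do rewrite rmorphM rmorph_prod /= mulrACA -big_split /=.
rewrite -mulr_suml -(bigA_distr_bigA (fun i k => K (m i) k * (K (m' i) k)^*)).
have [i mi_neq] : exists i, m i != m' i.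
  apply/existsP; apply: contra_neqT m'_neq => /existsPn m_eq.
  by apply/ffunP => i; apply/esym/eqP/negbNE/m_eq.
by rewrite (bigD1 i) //= unitaryK (negPf mi_neq) !mul0r.
Qed.

(** * Sums over powers of a root of unity *)

Lemma sum_expr_unity_root (F : fieldType) (N : nat) (x : F) :
  x ^+ N = 1 -> \sum_(a < N) x ^+ a = if x == 1 then N%:R else 0.
Proof.
move=> xN1; case: eqVneq => [->|x_neq1].
  by under eq_bigr do rewrite expr1n; rewrite sumr_const card_ord.
apply: (mulfI (x := x - 1)); first by rewrite subr_eq0.
by rewrite -subrX1 xN1 subrr mulr0.
Qed.

(** The product expands into four geometric sums, with ratios [z ^ (b + c)], [z ^ (b - c)] and their
    inverses. The first kind vanishes because [N] does not divide [b + c]; the second enters with a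
    minus sign and survives only when [b = c]. *)
Lemma sine_orthogonality (F : fieldType) (N : nat) (z : F) (b c : nat) :
  N.-primitive_root z -> (b < N)%N -> (c < N)%N -> ~~ (N %| b + c)%N ->
  \sum_(a < N) (z ^+ (b * a) - z ^- (b * a)) * (z ^+ (c * a) - z ^- (c * a)) =
  if b == c then - 2 * N%:R else 0.
Proof.
move=> zP bN cN bcN.
have z0 k : z ^+ k != 0.
  by rewrite expf_neq0 // (prim_root_eq0 zP) -lt0n (prim_order_gt0 zP).
have zN k : (z ^+ k) ^+ N = 1 by rewrite exprAC (prim_expr_order zP) expr1n.
have eq_bc : (z ^+ b == z ^+ c) = (b == c).
  by rewrite (eq_prim_root_expr zP) !modn_small.
have eq1_div i j : (z ^+ i / z ^+ j == 1) = (z ^+ i == z ^+ j).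
  by rewrite (can2_eq (divfK (z0 j)) (mulfK (z0 j))) mul1r.
transitivity (\sum_(a < N) ((z ^+ (b + c)) ^+ a + ((z ^+ (b + c))^-1) ^+ a
   - (z ^+ b / z ^+ c) ^+ a - (z ^+ c / z ^+ b) ^+ a)).
  apply: eq_bigr => a _; rewrite !exprD !(exprMn, exprVn) -!exprM.
  have := z0 (b * a)%N; have := z0 (c * a)%N.
  by move: (z ^+ (c * a)) (z ^+ (b * a)) => x y x0 y0; field; rewrite x0 y0.
rewrite !sumrB big_split /= !sum_expr_unity_root
  ?expr_div_n ?exprVn ?zN ?divr1 ?invr1 //.
rewrite invr_eq1 -(prim_order_dvd zP) (negPf bcN) addr0 !sub0r.
rewrite !eq1_div [z ^+ c == _]eq_sym eq_bc.
by case: eqP => _; ring.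
Qed.

Lemma sum_reflect (F : comPzRingType) (N : nat) (g h : nat -> F) :
  (forall a, (a <= N)%N -> g a = h a + h (N - a)%N) -> g N = 0 ->
  \sum_(a < N) g a = 2 * \sum_(a < N.+1) h a.
Proof.
(* Adding the zero term at [N] makes the range stable under [a <-> N - a]. *)
move=> gE gN0; transitivity (\sum_(a < N.+1) g a).
  by rewrite big_ord_recr /= gN0 addr0.
rewrite (eq_bigr (fun a : 'I_N.+1 => h a + h (N - a)%N)); last first.
  by move=> a _; rewrite gE // -ltnS.
rewrite big_split /= [X in _ + X](reindex_inj rev_ord_inj) /=.
rewrite mulr2n mulrDl !mul1r.
by congr (_ + _); apply: eq_bigr => a _; rewrite subSS subKn // -ltnS.
Qed.

(** * Complex exponentials on the unit circle *)

Section Expi.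
Variable R : realType.

Lemma expiD (s t : R) : expi (s + t) = expi s * expi t.
Proof.
rewrite /expi cosD sinD; apply/eqP; rewrite eq_complex /=; apply/andP.
by split; apply/eqP; ring.
Qed.

Lemma expiX (t : R) (k : nat) : expi t ^+ k = expi (k%:R * t).
Proof.
elim: k => [|k IHk]; first by rewrite mul0r /expi cos0 sin0 expr0.
by rewrite exprS IHk -expiD; congr expi; rewrite -natr1; ring.
Qed.

Lemma norm_expi (t : R) : `|expi t| = 1.
Proof. by rewrite normc_def /= cos2Dsin2 sqrtr1. Qed.

Lemma conj_expi (t : R) : (expi t)^* = (expi t)^-1.
Proof. by rewrite invC_norm norm_expi expr1n invr1 mul1r. Qed.

End Expi.

Lemma expi_inv (R : realType) (t : R) : (expi t)^-1 = (cos t +i* - sin t)%C.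
Proof. by rewrite -conj_expi. Qed.

Lemma expi_prim_root (R : realType) (N : nat) :
  (0 < N)%N -> N.-primitive_root (expi (2 * pi / N%:R : R)).
Proof.
move=> N0; have NR : N%:R != 0 :> R by rewrite pnatr_eq0 -lt0n.
apply/andP; split=> //; apply/forallP => i; apply/eqP.
rewrite unity_rootE expiX; case: (ltngtP i.+1 N) (ltn_ord i) => // [iN _|-> _].
  (* The real part is [cos (2 x) = 1 - 2 sin^2 x] with [0 < x < pi], hence less than 1. *)
  apply/negbTE; rewrite eq_complex negb_and; apply/orP; left => /=.
  have -> : i.+1%:R * (2 * pi / N%:R) = (i.+1%:R * pi / N%:R) *+ 2 :> R.
    by rewrite -mulr_natl; ring.
  rewrite mulr2n cosD -!expr2 cos2sin2.
  have : 0 < sin (i.+1%:R * pi / N%:R : R).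
    apply: sin_gt0_pi; rewrite divr_gt0 ?mulr_gt0 ?pi_gt0 ?ltr0n //=.
    by rewrite ltr_pdivrMr ?ltr0n // mulrC ltr_pM2l ?pi_gt0 // ltr_nat.
  by move=> s0; rewrite lt_eqF //; nra.
have -> : N%:R * (2 * pi / N%:R) = pi *+ 2 :> R by rewrite -mulr_natl; field.
by rewrite /expi cos2pi sin2pi; apply/eqP.
Qed.

(** * Unitarity of the normalized Fourier kernel *)

Section Kernel.
Variables (R : realType) (T : theory) (r : nat).
Hypothesis hr : admissible T r.

Definition q_order : nat := match T with SU2 => 2 * r | SO3 => r end.

Lemma rt_q_expi : rt_q R T r = expi (2 * pi / q_order%:R).
Proof.
rewrite /rt_q /q_order; case: T => //; congr expi.
by rewrite natrM invfM mulrACA divff ?mul1r // pnatr_eq0.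
Qed.

Lemma rt_q_prim_root : q_order.-primitive_root (rt_q R T r).
Proof.
rewrite rt_q_expi; apply: expi_prim_root.
by move: hr; rewrite /q_order; case: T => /=; lia.
Qed.

(** Otherwise [q ^ 2 = 1], while the order of [q] is at least 3. *)
Lemma rt_q_subV_neq0 : rt_q R T r - (rt_q R T r)^-1 != 0.
Proof.
have qP := rt_q_prim_root.
have q0 : rt_q R T r != 0.
  by rewrite (prim_root_eq0 qP) -lt0n (prim_order_gt0 qP).
rewrite subr_eq0; apply/eqP => qV; have : rt_q R T r ^+ 2 = 1.
  by rewrite expr2 {2}qV divff.
move/eqP; rewrite -(prim_order_dvd qP) => /dvdn_leq.
by move: hr; rewrite /q_order; case: T => /=; lia.
Qed.

(** This normalization gives the rows of [mu H] norm 1. Writing [q = expi t], both sides equal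
    [4 sin^2 t]. *)
Lemma rt_mu_sqr :
  rt_mu R T r ^+ 2 * q_order%:R = - (rt_q R T r - (rt_q R T r)^-1) ^+ 2.
Proof.
have subV (t : R) : - (expi t - (expi t)^-1) ^+ 2 = (4 * sin t ^+ 2)%:C%C.
  rewrite expi_inv /expi; apply/eqP; rewrite eq_complex /=; apply/andP.
  by split; apply/eqP; ring.
have r0 : (0 : R) < r%:R by rewrite ltr0n; move: hr; case: T => /=; lia.
rewrite /rt_mu /rt_q /q_order; case: T; rewrite subV -rmorphXn /=
  -[X in _ * X](rmorph_nat (real_complex R)) -rmorphM /=; congr (_%:C)%C;
  rewrite !exprMn exprVn !sqr_sqrtr ?ltW // ?natrM; field; exact: lt0r_neq0.
Qed.

Lemma rt_mu_conj : (rt_mu R T r)^* = rt_mu R T r.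
Proof. exact: conjc_real. Qed.

Lemma rt_q_conj : (rt_q R T r)^* = (rt_q R T r)^-1.
Proof. by rewrite rt_q_expi conj_expi. Qed.

(** Conjugation inverts [q], which changes the sign of both the numerator and the denominator. *)
Lemma fourier_kernel_conj m k :
  (fourier_kernel R T r m k)^* = fourier_kernel R T r m k.
Proof.
rewrite /fourier_kernel.
rewrite !(rmorphM, rmorphXn, rmorphB, rmorphN, rmorph1, fmorphV) /=.
rewrite rt_q_conj exprVn !invrK; congr (_ * _).
by rewrite -[X in X / _]opprB -[X in _ / X]opprB invrN mulrNN.
Qed.

(* The index a stands for color + 1, so that the kernel depends on q^(a b). *)
Lemma sum_color (V : nmodType) (G : nat -> V) :
  \sum_(k : color T r) G (color_val k).+1 =
  \sum_(a < q_order.+1 | (0 < a)%N && in_colors T r a.-1) G a.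
Proof.
have r_le : (r <= q_order)%N by rewrite /q_order; case: T => /=; lia.
rewrite -(big_sub (in_colors T r : pred 'I_r) (fun k => G k.+1)).
rewrite [RHS]big_mkcond big_ord_recl /= add0r -big_mkcond /=.
rewrite (big_ord_widen_cond q_order (in_colors T r) (fun k => G k.+1)) //.
apply: eq_bigl => a; rewrite andb_idr //.
by move: hr; case: T => /=; lia.
Qed.

(* Up to a <-> q_order - a, the values color + 1 are all residues modulo q_order
   except 0 and r: in the SO(3) theory the reflection exchanges odd and even. *)
Lemma color_sum_reflect (F : comPzRingType) (G : nat -> F) :
  (forall a, (a <= q_order)%N -> G (q_order - a)%N = G a) ->
  G 0%N = 0 -> G r = 0 ->
  \sum_(a < q_order) G a = 2 * \sum_(k : color T r) G (color_val k).+1.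
Proof.
move=> Gsym G0 Gr; rewrite sum_color [X in _ * X]big_mkcond /=.
apply: (sum_reflect _ _ G
  (fun a => if (0 < a)%N && in_colors T r a.-1 then G a else 0)) => [a aN|].
  rewrite Gsym //; case: (eqVneq (G a) 0) => [->|Ga].
    by rewrite !if_same addr0.
  have a0 : a != 0%N by apply: contra_neq Ga => ->.
  have ar : a != r by apply: contra_neq Ga => ->.
  have aN' : a != q_order.
    by apply: contra_neq Ga => ->; rewrite -[q_order in LHS]subn0 Gsym.
  case: ifP => aQ; case: ifP => aQ'; rewrite ?addr0 ?add0r //; exfalso;
    by move: hr aN aQ aQ' a0 ar aN'; rewrite /q_order; case: T => /=; lia.
by rewrite -[q_order in LHS]subn0 Gsym.
Qed.

(** For [SU2] the sum lies strictly between 0 and [2 r]. For [SO3] it lies in the same range and is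
    even, so it cannot be the odd number [r]. *)
Lemma color_sumN (m m' : color T r) :
  ~~ (q_order %| (color_val m).+1 + (color_val m').+1)%N.
Proof.
case: m m' => -[m mr] /= mC [[m' mr'] /= mC']; rewrite /color_val /=.
apply/negP => /dvdnP [d]; move: hr mC mC'; rewrite /q_order /in_colors.
case: T => /=; case: d => [|[|d]]; lia.
Qed.

Lemma color_lt_order (m : color T r) : ((color_val m).+1 < q_order)%N.
Proof.
case: m => -[m mr] /= mC; rewrite /color_val /=.
by move: hr mC; rewrite /q_order /in_colors; case: T => /=; lia.
Qed.

(** The order of [q] divides [2 r]; hence [q ^ (b r)] is its own inverse and the sine factors vanish
    at [r]. *)
Lemma rt_q_half_order_sqr (b : nat) : (rt_q R T r ^+ (b * r)) ^+ 2 = 1.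
Proof.
apply/eqP; rewrite -exprM -(prim_order_dvd rt_q_prim_root).
rewrite -mulnA [(r * 2)%N]mulnC.
by apply: dvdn_mull; rewrite /q_order; case: T => //; apply: dvdn_mull.
Qed.

Lemma fourier_kernel_unitary (m m' : color T r) :
  \sum_(k : color T r)
    (rt_mu R T r * fourier_kernel R T r (color_val m) (color_val k)) *
    (rt_mu R T r * fourier_kernel R T r (color_val m') (color_val k))^* =
  (m == m')%:R.
Proof.
have qP := rt_q_prim_root; have d0 := rt_q_subV_neq0; have muN := rt_mu_sqr.
pose s b a := rt_q R T r ^+ (b * a) - rt_q R T r ^- (b * a).
have q0 b : rt_q R T r ^+ b != 0.
  by rewrite expf_neq0 // (prim_root_eq0 qP) -lt0n (prim_order_gt0 qP).
have s_sym b a : (a <= q_order)%N -> s b (q_order - a)%N = - s b a.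
  move=> aN.
  have qq : rt_q R T r ^+ (b * (q_order - a)) * rt_q R T r ^+ (b * a) = 1.
    by rewrite -exprD -mulnDr subnK // mulnC exprM (prim_expr_order qP) expr1n.
  rewrite /s (_ : rt_q R T r ^+ (b * (q_order - a)) = rt_q R T r ^- (b * a)).
    by rewrite invrK opprB.
  by rewrite -[LHS](mulfK (q0 (b * a)%N)) qq mul1r.
have s0 b : s b 0%N = 0 by rewrite /s muln0 expr0 invr1 subrr.
have sr b : s b r = 0.
  apply/eqP; rewrite subr_eq0; apply/eqP; apply: (mulfI (q0 (b * r)%N)).
  by rewrite -expr2 rt_q_half_order_sqr divff.
pose G a := s (color_val m).+1 a * s (color_val m').+1 a.
have sumG : 2 * \sum_(k : color T r) G (color_val k).+1 =
    (if m == m' then - 2 * q_order%:R else 0).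
  rewrite -color_sum_reflect ?/G => [|a aN||]; last 3 first.
  - by rewrite !s_sym // mulrNN.
  - by rewrite s0 mul0r.
  - by rewrite sr mul0r.
  by rewrite (sine_orthogonality _ _ _ _ _ qP) ?color_lt_order ?color_sumN //.
move: muN d0; set mu := rt_mu R T r; set d := (X in X != 0) => muN d0.
(* The kernel is real and the sign of [k] occurs twice, so only the signs of [m] and [m'] remain
   outside the sum. *)
transitivity (mu ^+ 2 * (-1) ^+ (color_val m + color_val m') / d ^+ 2 *
    \sum_(k : color T r) G (color_val k).+1).
  rewrite mulr_sumr; apply: eq_bigr => k _.
  rewrite rmorphM /= rt_mu_conj fourier_kernel_conj /fourier_kernel -/mu -/d.
  rewrite !exprD /G -/(s (color_val m).+1 (color_val k).+1).
  rewrite -/(s (color_val m').+1 (color_val k).+1).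
  have := sqrr_sign R[i] (color_val k).
  move: (s _ _) (s _ _) ((-1) ^+ color_val k).
  move: ((-1) ^+ color_val m) ((-1) ^+ color_val m').
  by move=> u v x y e e2; rewrite -[RHS]mul1r -e2; field.
have -> : \sum_(k : color T r) G (color_val k).+1 =
    if m == m' then - q_order%:R else 0.
  apply: (mulfI (x := 2)); first by rewrite pnatr_eq0.
  by rewrite sumG; case: eqP => _; ring.
case: eqP => [->|_]; last by rewrite mulr0.
(* On the diagonal the remaining signs cancel too, and [rt_mu_sqr] gives exactly 1. *)
rewrite exprD -expr2 sqrr_sign mulr1.
have -> : mu ^+ 2 / d ^+ 2 * - q_order%:R =
    - (mu ^+ 2 * q_order%:R) / d ^+ 2 by ring.
by rewrite muN opprK divff // expf_neq0.
Qed.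

End Kernel.

Theorem mainTheorem5 (R : realType) (T : theory) (r : nat)
    (hr : admissible T r)
    (M : closed_oriented_3manifold R) (n : nat) (L : framed_link R M 'I_n)
    (P : surgery_presentation L)
    (f : {ffun 'I_n -> color T r} -> R[i])
    (hf : forall m, f m = RT P m) :
  \sum_(m : {ffun 'I_n -> color T r}) `|f m| ^+ 2 =
  \sum_(k : {ffun 'I_n -> color T r}) `|fourier f k| ^+ 2.
Proof.
(* The factor [mu ^ n] is spread over the coordinates, one [mu] per kernel. *)
rewrite -(parseval_ffun _ _ _ (fun a b : color T r =>
  rt_mu R T r * fourier_kernel R T r (color_val a) (color_val b)) f); last first.
  exact: fourier_kernel_unitary.
apply: eq_bigr => k _; congr (`|_| ^+ 2); rewrite /fourier mulr_sumr.
apply: eq_bigr => m _.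
by rewrite big_split /= prodr_const card_ord mulrA.
Qed.
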